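(* Let $n,d\ge 1$ be integers, let $M>0$ be a real number, and let $f=\sum_{\alpha} f_\alpha \mathbf{x}^\alpha\in\mathbb{R}[\mathbf{x}]=\mathbb{R}[x_1,\dots,x_n]$ be a polynomial of degree at most $2d$. For $i=1,\dots,n$ let $f_{2d,i}$ denote the coefficient of $x_i^{2d}$ in $f$, and assume the variables are labeled so that $f_{2d,1}\ge f_{2d,2}\ge\cdots\ge f_{2d,n}$. Let $$f_{*,M}:=\min\Big\{f(\mathbf{x}) : \mathbf{x}\in\mathbb{R}^n,\ \sum_{i=1}^n x_i^{2d}\le M\Big\}.$$ Then $$f_{*,M}\ \ge\ f(0)+M f_{2d,1}-\rho_M,$$ where $\rho_M$ is the optimal value of the following geometric program in the unknowns $\mathbf{z}_\alpha=(z_{\alpha,1},\dots,z_{\alpha,n})$, $\alpha\in\Delta(f)$, and $\mathbf{u}=(u_1,\dots,u_n)$: minimize $$M u_1+\sum_{\alpha\in\Delta(f)^{<2d}}(2d-|\alpha|)\left[\left(\frac{f_\alpha}{2d}\right)^{2d}\left(\frac{\alpha}{\mathbf{z}_\alpha}\right)^{\alpha}\right]^{1/(2d-|\alpha|)}$$ subject to $$\sum_{\alpha\in\Delta(f)}\frac{z_{\alpha,i}}{u_i}\le 1\quad (i=1,\dots,n),$$ $$\left(\frac{2d}{f_\alpha}\right)^{2d}\left(\frac{\mathbf{z}_\alpha}{\alpha}\right)^{\alpha}=1\quad\text{for all }\alpha\in\Delta(f)\text{ with }|\alpha|=2d,$$ $$\frac{f_{2d,1}}{u_1}\le 1,$$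 $$\frac{u_i}{u_{i-1}}+\frac{f_{2d,i-1}-f_{2d,i}}{u_{i-1}}\le 1\quad (i=2,\dots,n),$$ where $u_i>0$ for all $i$, and for every $\alpha\in\Delta(f)$ the unknown $\mathbf{z}_\alpha$ ranges over vectors in $\mathbb{R}^n_+$ (nonnegative entries) satisfying $z_{\alpha,i}=0$ if and only if $\alpha_i=0$.
   Context: $\mathbb{N}=\{0,1,2,\dots\}$. For $\alpha\in\mathbb{N}^n$, $|\alpha|=\sum_i\alpha_i$ and $\mathbf{x}^\alpha=x_1^{\alpha_1}\cdots x_n^{\alpha_n}$; $\mathbb{N}^n_{2d}=\{\alpha\in\mathbb{N}^n:|\alpha|\le 2d\}$; $\epsilon_i\in\mathbb{N}^n$ is the $i$-th standard unit vector. For $f=\sum f_\alpha\mathbf{x}^\alpha$ of degree at most $2d$: $\Omega(f):=\{\alpha\in\mathbb{N}^n_{2d}: f_\alpha\ne 0\}\setminus\{0,2d\epsilon_1,\dots,2d\epsilon_n\}$; $\Delta(f):=\{\alpha\in\Omega(f): f_\alpha\mathbf{x}^\alpha\text{ is not a square in }\mathbb{R}[\mathbf{x}]\}$; $\Delta(f)^{<2d}:=\{\alpha\in\Delta(f):|\alpha|<2d\}$. Moreover $\left(\frac{\alpha}{\mathbf{z}_\alpha}\right)^{\alpha}:=\prod_{i=1}^n\frac{\alpha_i^{\alpha_i}}{z_{\alpha,i}^{\alpha_i}}$ and $\left(\frac{\mathbf{z}_\alpha}{\alpha}\right)^{\alpha}:=\prod_{i=1}^n\frac{z_{\alpha,i}^{\alpha_i}}{\alpha_i^{\alpha_i}}$,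 with the convention $0^0=1$. The optimal value of a minimization program is the infimum of the objective over the feasible set. A geometric program is the minimization of a posynomial in positive variables subject to constraints of the form ''posynomial $\le 1$'' and ''monomial $=1$'' (constraints that are trivially satisfied may be ignored; the entries $z_{\alpha,i}$ with $\alpha_i=0$ are fixed to $0$ and are not variables). *)

(* Defs.v *)
(* The notations of mpoly.v clash with those of MathComp-Analysis, so they are
   not imported. *)
From HB Require Import structures.
From mathcomp Require Export all_boot all_order all_algebra.
From mathcomp Require Export all_classical all_reals all_analysis.
From mathcomp Require Export -(notations) mpoly.

Set Implicit Arguments.
Unset Strict Implicit.
Unset Printing Implicit Defensive.

Import Order.TTheory GRing.Theory Num.Theory.

Local Open Scope classical_set_scope.
Local Open Scope ring_scope.

(* The infimum, in the extended reals, of an objective over a feasible set;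
   it is +oo when the set is empty. *)
Definition optimal_value (R : realType) (T : Type) (feasible : set T)
    (objective : T -> R) : \bar R :=
  ereal_inf [set (objective t)%:E | t in feasible].

Definition is_minimum (R : realType) (T : Type) (A : set T) (F : T -> R)
    (v : R) : Prop :=
  (exists2 t, A t & F t = v) /\ (forall t, A t -> v <= F t).

Section Polynomial.
Variables (R : realType) (n d : nat).
Implicit Types (f p : mpoly n R) (a : multinom n) (i : 'I_n).

(* The exponent vector 2d eps_i. *)
Definition pure_exp i : multinom n := mnm_muln (mnm1 i) (2 * d).

Definition pure_coef f i : R := mcoeff (pure_exp i) f.

Definition is_square p : Prop := exists q : mpoly n R, p = q ^+ 2.

(* These sequences represent finite sets: they are duplicate-free
   because msupp f is. *)
Definition Omega f : seq (multinom n) :=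
  [seq a <- msupp f |
    [&& (mdeg a <= 2 * d)%N, a != mnm0 & [forall i, a != pure_exp i]]].

Definition Delta f : seq (multinom n) :=
  [seq a <- Omega f | `[< ~ is_square (mcoeff a f *: mpolyX R a) >]].

Definition Delta_lt f : seq (multinom n) :=
  [seq a <- Delta f | (mdeg a < 2 * d)%N].

(* All powers below have natural exponents, so 0 ^+ 0 = 1. *)
Definition ratio_az a (w : 'I_n -> R) : R :=
  \prod_(i < n) ((a i)%:R ^+ a i / w i ^+ a i).

Definition ratio_za a (w : 'I_n -> R) : R :=
  \prod_(i < n) (w i ^+ a i / (a i)%:R ^+ a i).

Definition power_ball (M : R) : set ('I_n -> R) :=
  [set x | \sum_(i < n) x i ^+ (2 * d) <= M].

End Polynomial.

(* There are n.+1 >= 1 variables; x_1 is the one of index ord0. *)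
Section GeometricProgram.
Variables (R : realType) (n d : nat) (M : R) (f : mpoly n.+1 R).

(* A point is a pair (z, u); only the values z a for a in Delta matter. *)
Definition gp_point : Type :=
  ((multinom n.+1 -> 'I_n.+1 -> R) * ('I_n.+1 -> R))%type.

Definition gp_objective (t : gp_point) : R :=
  let: (z, u) := t in
  M * u ord0 +
  \sum_(a <- Delta_lt d f)
     (2 * d - mdeg a)%N%:R *
     ((mcoeff a f / (2 * d)%N%:R) ^+ (2 * d) * ratio_az a (z a))
       `^ ((2 * d - mdeg a)%N%:R)^-1.

Definition gp_domain (t : gp_point) : Prop :=
  let: (z, u) := t in
  (forall i, 0 < u i) /\
  (forall a, a \in Delta d f ->
     forall i, 0 <= z a i /\ (z a i = 0 <-> a i = 0%N)).

Definition gp_constraints (t : gp_point) : Prop :=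
  let: (z, u) := t in
  [/\ forall i, \sum_(a <- Delta d f) z a i / u i <= 1,
      forall a, a \in Delta d f -> mdeg a = (2 * d)%N ->
        ((2 * d)%N%:R / mcoeff a f) ^+ (2 * d) * ratio_za a (z a) = 1,
      pure_coef d f ord0 / u ord0 <= 1 &
      forall i j : 'I_n.+1, i = j.+1 :> nat ->
        u i / u j + (pure_coef d f j - pure_coef d f i) / u j <= 1].

Definition gp_feasible : set gp_point :=
  [set t | gp_domain t /\ gp_constraints t].

Definition gp_value : \bar R := optimal_value gp_feasible gp_objective.

End GeometricProgram.

(* Main.v *)
Require Import Defs.
From mathcomp Require Import all_boot all_order all_algebra.
From mathcomp Require Import all_classical all_reals all_analysis.
From mathcomp Require Import -(notations) mpoly.
From mathcomp Require Import ring lra.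

Set Implicit Arguments.
Unset Strict Implicit.
Unset Printing Implicit Defensive.

Import Order.TTheory GRing.Theory Num.Theory.
Import numFieldNormedType.Exports.

Local Open Scope ring_scope.

(** Write c_i for the coefficient of x_i^(2d).  Then f is the sum
    f(0) + sum_i c_i x_i^(2d) + (the terms of Omega).  The terms of Omega that
    are squares are nonnegative and can be dropped.  Each remaining term
    satisfies, by the weighted AM-GM inequality applied to the numbers
    z_(a,i) x_i^(2d) / a_i with weights a_i and one extra constant with weight
    2d - |a|,
      |f_a x^a| <= sum_i z_(a,i) x_i^(2d) + slack_a,
    where slack_a is exactly the contribution of a to the objective of the
    geometric program; for |a| = 2d there is no room for a constant, and the
    equality constraint on z_a makes the same inequality hold with slack_a = 0
    ([monomial_bound], [Delta_term_bound]).

    Summing over a and using sum_a z_(a,i) <= u_i gives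
      f(x) >= f(0) + sum_i (c_i - u_i) x_i^(2d) - sum_a slack_a.
    The last family of constraints says that c_i - u_i is nondecreasing in i,
    and the one before it that c_1 - u_1 <= 0.  So each c_i - u_i may be
    replaced by c_1 - u_1, and then sum_i x_i^(2d) by its upper bound M.  This
    gives f(x) >= f(0) + M c_1 - objective for every feasible point
    ([gp_lower_bound]), hence the bound by the infimum.  The minimum of f
    exists because the ball is compact and f is continuous ([meval_min]). *)

(** * The weighted AM-GM inequality and monomials *)

(** This is the unweighted inequality for the family in which e_i is repeated
    w_i times, that is, the family indexed by the pairs (i, j) with j < w_i. *)
Lemma weighted_AGM (F : numDomainType) (I : finType) (w : I -> nat)
    (e : I -> F) (N := (\sum_i w i)%N) : (forall i, 0 <= e i) ->
  \prod_i (e i *+ N) ^+ w i <= (\sum_i e i *+ w i) ^+ N.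
Proof.
move=> e_ge0.
have cardN : #|{: {i : I & 'I_(w i)}}| = N.
  by rewrite card_tagged sumnE big_map big_enum; apply: eq_bigr => i _; rewrite card_ord.
have := @leif_AGM_scaled F {i : I & 'I_(w i)} predT (fun p => e (tag p)).
rewrite cardN => /(_ (fun p _ => mulrn_wge0 N (e_ge0 (tag p)))) [+ _].
rewrite -(@sig_big_dep _ _ _ _ _ xpredT (fun _ => xpredT) (fun i _ => e i)).
rewrite -(@sig_big_dep _ _ _ _ _ xpredT (fun _ => xpredT) (fun i _ => e i *+ N)).
under eq_bigr do rewrite prodr_const card_ord.
by under [X in _ <= X ^+ _ -> _]eq_bigr do rewrite sumr_const card_ord.
Qed.

Lemma even_powerE (R : realDomainType) (d : nat) (t : R) :
  `|t| ^+ (2 * d) = t ^+ (2 * d).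
Proof. by rewrite !exprM real_normK ?num_real. Qed.

Lemma ratio_za_gt0 (R : realType) n (a : multinom n) (w : 'I_n -> R) :
  (forall i, 0 <= w i /\ (w i = 0 <-> a i = 0%N)) -> 0 < ratio_za a w.
Proof.
move=> hw; apply: prodr_gt0 => i _; have [w0 wa] := hw i.
have [ai0|ai0] := eqVneq (a i) 0%N; first by rewrite ai0 !expr0 divr1.
rewrite divr_gt0// exprn_gt0 ?ltr0n ?lt0n//.
by rewrite lt_neqAle w0 eq_sym andbT; apply: contra_neq ai0 => /wa.
Qed.

Lemma ratio_azE (R : realType) n (a : multinom n) (w : 'I_n -> R) :
  ratio_az a w = (ratio_za a w)^-1.
Proof. by rewrite /ratio_za -prodfV; apply: eq_bigr => i _; rewrite invf_div. Qed.

(** The constant C absorbs the weight k = D - |a| that the monomial leaves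
    unused.  With e_i = w_i x_i^D / a_i, the hypothesis on C says that the
    weighted product of the e_i and C, scaled by D^D, is exactly the D-th power
    of the left-hand side.  For k = 0 it no longer mentions C, which is why the
    cases |a| < 2d and |a| = 2d need only one statement. *)
Lemma monomial_bound (R : realType) (n k D : nat) (a : multinom n)
    (w x : 'I_n -> R) (c C : R) :
  (0 < D)%N -> (mdeg a + k)%N = D ->
  (forall i, 0 <= w i /\ (w i = 0 <-> a i = 0%N)) ->
  (forall i, 0 <= x i) -> 0 <= c -> 0 <= C ->
  ratio_za a w * C ^+ k = (c / D%:R) ^+ D ->
  c * \prod_i x i ^+ a i <= \sum_i w i * x i ^+ D + k%:R * C.
Proof.
move=> D_gt0 degD hw x_ge0 c_ge0 C_ge0 hC.
have w_ge0 i : 0 <= w i by case: (hw i).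
have px_ge0 : 0 <= \prod_i x i ^+ a i by apply: prodr_ge0 => i _; exact: exprn_ge0.
rewrite -(@ler_pXn2r _ D)// ?nnegrE; last 2 first.
- exact: mulr_ge0.
- by rewrite addr_ge0 ?mulr_ge0// sumr_ge0// => i _; rewrite mulr_ge0 ?exprn_ge0.
(* The element tt of the second summand indexes the constant C. *)
pose wt (s : 'I_n + unit) := if s is inl i then a i else k.
pose e (s : 'I_n + unit) := if s is inl i then w i * x i ^+ D / (a i)%:R else C.
have e_ge0 s : 0 <= e s.
  by case: s => //= i; rewrite !mulr_ge0 ?invr_ge0 ?exprn_ge0.
have := weighted_AGM wt e_ge0.
have -> : (\sum_s wt s)%N = D.
  by rewrite big_sumType/= -mdegE big_const card_unit /= addn0.
rewrite !big_sumType /= !(big_pred1 tt) /=; [|by case..].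
have -> : \sum_i (w i * x i ^+ D / (a i)%:R) *+ a i = \sum_i w i * x i ^+ D.
  apply: eq_bigr => i _.
  (* For a_i = 0 the weight kills e_i, and w_i = 0 by hypothesis. *)
  have [ai0|ai0] := eqVneq (a i) 0%N.
    by rewrite ai0 mulr0n; case: (hw i) => _ [_ ->//]; rewrite mul0r.
  by rewrite -mulr_natr divfK// pnatr_eq0.
rewrite -[C *+ k]mulr_natl; apply: le_trans.
rewrite le_eqVlt; apply/orP; left; apply/eqP.
have D0 : D%:R != 0 :> R by rewrite pnatr_eq0 -lt0n.
have -> : \prod_i (w i * x i ^+ D / (a i)%:R *+ D) ^+ a i =
    D%:R ^+ mdeg a * ratio_za a w * (\prod_i x i ^+ a i) ^+ D.
  rewrite mdegE -prodrXr -prodrXl -!big_split/=; apply: eq_bigr => i _.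
  by rewrite -mulr_natl !exprMn exprVn exprAC; ring.
rewrite -[C *+ D]mulr_natl !exprMn.
transitivity (D%:R ^+ D * (ratio_za a w * C ^+ k) * (\prod_i x i ^+ a i) ^+ D).
  by rewrite hC expr_div_n; field; rewrite expf_neq0.
rewrite -[X in D%:R ^+ X * (ratio_za a w * _) * _]degD exprD.
set A := D%:R ^+ mdeg a; set B := D%:R ^+ k.
ring.
Qed.

(** * Existence of the minimum *)

Lemma meval_continuous (R : realType) n (f : mpoly n R) :
  continuous (fun v : 'rV[R]_n => meval (v ord0) f).
Proof.
apply: (@continuous_big R _ +%R 0 xpredT _ 'rV[R]_n (msupp f)
  (fun m (v : 'rV[R]_n) => mcoeff m f * \prod_i v ord0 i ^+ m i)) => [|m _].
  exact: add_continuous.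
have cX : continuous (fun v : 'rV[R]_n => \prod_i v ord0 i ^+ m i).
  apply: (@continuous_big R _ *%R 1 xpredT _ 'rV[R]_n (index_enum 'I_n)
    (fun i (v : 'rV[R]_n) => v ord0 i ^+ m i)) => [|i _].
    exact: mul_continuous.
  move=> v; apply: (@continuous_comp _ _ _ (fun v : 'rV[R]_n => v ord0 i)
    (fun t => t ^+ m i)); first exact: coord_continuous.
  exact: exprn_continuous.
by move=> v; exact: (cvgM (cvg_cst (mcoeff m f)) (cX v)).
Qed.

(** The points are taken as row vectors, whose norm makes bounded closed sets
    compact.  The ball is bounded since a coordinate t with |t| > 1 satisfies
    |t| <= t^(2d) <= M. *)
Lemma power_ball_compact (R : realType) n d (M : R) : (0 < d)%N ->
  compact [set v : 'rV[R]_n | power_ball d M (v ord0)]%classic.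
Proof.
move=> d_gt0; apply: bounded_closed_compact.
  exists (1 + `|M|); split; first exact: num_real.
  move=> y /ltW My v /= vM; apply: le_trans My.
  rewrite [leLHS]/Num.norm/= mx_normrE; apply: bigmax_le => [|[i j] _] /=.
    by rewrite addr_ge0.
  rewrite ord1; have [vij1|vij1] := leP `|v ord0 j| 1.
    by rewrite (le_trans vij1)// lerDl.
  apply: (@le_trans _ _ M); last by rewrite (le_trans (ler_norm _))// lerDr.
  apply: le_trans vM; rewrite (bigD1 j)//=.
  apply: (@le_trans _ _ (v ord0 j ^+ (2 * d))).
    by rewrite -even_powerE ler_eXnr ?muln_gt0// ltW.
  by rewrite lerDl sumr_ge0// => k _; rewrite -even_powerE exprn_ge0.
have /continuous_closedP : continuous (fun v : 'rV[R]_n => \sum_i v ord0 i ^+ (2 * d)).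
  apply: (@continuous_big R _ +%R 0 xpredT _ 'rV[R]_n (index_enum 'I_n)
    (fun i (v : 'rV[R]_n) => v ord0 i ^+ (2 * d))) => [|i _]; first exact: add_continuous.
  move=> v; apply: (@continuous_comp _ _ _ (fun v : 'rV[R]_n => v ord0 i)
    (fun t => t ^+ (2 * d))); first exact: coord_continuous.
  exact: exprn_continuous.
by move=> /(_ _ (@closed_le R M)).
Qed.

Lemma meval_min (R : realType) n d (M : R) (f : mpoly n R) :
  (0 < d)%N -> 0 <= M ->
  exists v, is_minimum (power_ball d M) (fun x => meval x f) v.
Proof.
move=> d_gt0 M_ge0.
have ball0 : ([set v : 'rV[R]_n | power_ball d M (v ord0)] !=set0)%classic.
  exists 0; rewrite /= /power_ball /= big1// => i _.
  by rewrite mxE expr0n muln_eq0 /= (gtn_eqF d_gt0).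
have [c cM fc] := EVT_min_rV ball0 (@power_ball_compact R n d M d_gt0)
  (continuous_subspaceT (@meval_continuous R n f)).
exists (meval (c ord0) f); split; first by exists (c ord0) => //; exact/set_mem.
move=> x xM; pose v := \row_i x i.
have vx : v ord0 = x by apply/funext => i; rewrite mxE.
by have := fc v; rewrite vx; apply; rewrite inE /= vx.
Qed.

(** * Splitting a polynomial at the exponents 0 and 2d eps_i *)

Lemma sum_msupp_pred1 (R : realType) n (f : mpoly n R) (F : multinom n -> R) a :
  \sum_(m <- msupp f | m == a) mcoeff m f * F m = mcoeff a f * F a.
Proof.
rewrite -big_filter; have [af|af] := boolP (a \in msupp f).
  by rewrite filter_pred1_uniq ?msupp_uniq// big_seq1.
rewrite (memN_msupp_eq0 af) mul0r; apply: big1_seq => m /andP[_].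
by rewrite mem_filter => /andP[/eqP -> /(negP af)].
Qed.

Lemma monomial0 (R : realType) n (x : 'I_n -> R) :
  \prod_i x i ^+ (mnm0 : multinom n) i = 1.
Proof. by apply: big1 => i _; rewrite mnm0E. Qed.

Lemma monomial_pure (R : realType) n d (x : 'I_n -> R) i :
  \prod_j x j ^+ pure_exp d i j = x i ^+ (2 * d).
Proof.
rewrite (bigD1 i)//= big1 => [|j ji]; rewrite mulmnE mnm1E.
  by rewrite eqxx mul1n mulr1.
by rewrite eq_sym (negbTE ji).
Qed.

Lemma pure_exp_inj n d : (0 < d)%N -> injective (@pure_exp n d).
Proof.
move=> d_gt0 i j /(congr1 (fun m : multinom n => m i)) /eqP.
rewrite !mulmnE !mnm1E eqxx mul1n; have [->//|_] := eqVneq j i.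
by rewrite muln_eq0 /= (gtn_eqF d_gt0).
Qed.

Lemma pure_exp_neq0 n d (i : 'I_n) : (0 < d)%N -> pure_exp d i != mnm0.
Proof.
move=> d_gt0; apply/eqP => /(congr1 (fun m : multinom n => m i)) /eqP.
by rewrite mulmnE mnm1E mnm0E eqxx mul1n muln_eq0 /= (gtn_eqF d_gt0).
Qed.

Lemma meval0_mcoeff (R : realType) n (f : mpoly n R) :
  meval (fun=> 0) f = mcoeff mnm0 f.
Proof.
rewrite mevalE (bigID (pred1 mnm0))/= sum_msupp_pred1 monomial0 mulr1.
rewrite big1 ?addr0// => m m0.
have [i mi] : exists i, m i != 0%N.
  apply/existsP; apply: contra_neqT m0 => /existsPn mi0.
  by apply/mnmP => i; rewrite mnm0E; apply/eqP; have := mi0 i; rewrite negbK.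
by rewrite (bigD1 i)//= expr0n (negbTE mi) mul0r mulr0.
Qed.

(** The exponents 0 and 2d eps_i are pairwise distinct as d > 0, so no term is
    counted twice. *)
Lemma meval_decomp (R : realType) n d (f : mpoly n R) (x : 'I_n -> R) :
  (0 < d)%N -> (msize f <= (2 * d).+1)%N ->
  meval x f = meval (fun=> 0) f + \sum_i pure_coef d f i * x i ^+ (2 * d)
    + \sum_(a <- Omega d f) mcoeff a f * \prod_i x i ^+ a i.
Proof.
move=> d_gt0 degf; rewrite mevalE meval0_mcoeff (bigID (pred1 mnm0))/=.
rewrite sum_msupp_pred1 monomial0 mulr1 -addrA; congr +%R.
rewrite (bigID (fun m => [exists i, m == pure_exp d i]))/=; congr +%R.
  under [RHS]eq_bigr do rewrite -monomial_pure
    -(sum_msupp_pred1 f (fun m => \prod_j x j ^+ m j)).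
  under [RHS]eq_bigr do rewrite big_mkcond.
  rewrite [RHS]exchange_big/= big_mkcond/=; apply: eq_bigr => m _.
  rewrite -big_mkcond/=; case: existsP => [[i /eqP ->]|mpure].
    rewrite pure_exp_neq0//= [RHS](big_pred1 i)// => j.
    by rewrite (inj_eq (pure_exp_inj d_gt0)) eq_sym.
  by rewrite andbF big_pred0// => i; apply/negP => mi; apply: mpure; exists i.
rewrite big_filter big_seq_cond [RHS]big_seq_cond; apply: eq_bigl => m.
have [mf|//] := boolP (m \in msupp f); rewrite negb_exists/=.
by rewrite -ltnS (leq_trans (msize_mdeg_lt mf)).
Qed.

(** * The lower bound given by a feasible point *)

Lemma le_from_ord0 (R : realDomainType) n (g : 'I_n.+1 -> R) :
  (forall i j : 'I_n.+1, i = j.+1 :> nat -> g j <= g i) ->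
  forall i, g ord0 <= g i.
Proof.
move=> g_step [m]; elim: m => [|m IHm] lt_m.
  by rewrite (ord_inj (erefl : Ordinal lt_m = ord0 :> nat)).
by apply: le_trans (IHm (ltnW lt_m)) _; exact: g_step.
Qed.

(** The discarded terms are squares of polynomials, hence nonnegative at every
    point. *)
Lemma Delta_sum_le_Omega_sum (R : realType) n d (f : mpoly n R) (x : 'I_n -> R) :
  \sum_(a <- Delta d f) mcoeff a f * \prod_i x i ^+ a i <=
  \sum_(a <- Omega d f) mcoeff a f * \prod_i x i ^+ a i.
Proof.
rewrite /Delta big_filter.
rewrite [leRHS](bigID (fun a => `[< ~ is_square (mcoeff a f *: mpolyX R a) >]))/=.
rewrite lerDl sumr_ge0// => a /asboolPn/contrapT[q fq].
by rewrite -mevalX -mevalZ fq rmorphXn sqr_ge0.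
Qed.

(** The summand of the objective of the geometric program that belongs to a.
    When |a| = 2d it vanishes because of its first factor, so that sums over
    Delta and over Delta_lt agree. *)
Definition slack (R : realType) n d (f : mpoly n R) (a : multinom n)
    (w : 'I_n -> R) : R :=
  (2 * d - mdeg a)%N%:R *
     ((mcoeff a f / (2 * d)%N%:R) ^+ (2 * d) * ratio_az a w)
       `^ ((2 * d - mdeg a)%N%:R)^-1.

(** Instance of [monomial_bound] at |f_a| and the |x_i|, with
    C = b `^ (1 / k), where b is the base of the power in slack and
    k = 2d - |a|.  For k > 0, C ^+ k = b and ratio_az cancels ratio_za; for
    k = 0 the hypothesis of [monomial_bound] is the equality constraint of the
    geometric program. *)
Lemma Delta_term_bound (R : realType) n d (f : mpoly n R) (a : multinom n)
    (w x : 'I_n -> R) :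
  (0 < d)%N -> a \in Delta d f ->
  (forall i, 0 <= w i /\ (w i = 0 <-> a i = 0%N)) ->
  (mdeg a = (2 * d)%N ->
    ((2 * d)%N%:R / mcoeff a f) ^+ (2 * d) * ratio_za a w = 1) ->
  - (\sum_i w i * x i ^+ (2 * d) + slack d f a w)
    <= mcoeff a f * \prod_i x i ^+ a i.
Proof.
move=> d_gt0 aD hw htop; have za_gt0 := ratio_za_gt0 hw.
have /andP[lead fa0] : (mdeg a <= 2 * d)%N && (mcoeff a f != 0).
  by move: aD; rewrite !mem_filter mcoeff_msupp => /and3P[_ /and3P[-> _ _] ->].
rewrite lerNl; apply: le_trans (ler_norm _) _.
rewrite normrN normrM normr_prod; under eq_bigr do rewrite normrX.
under [X in _ <= X + _]eq_bigr do rewrite -even_powerE.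
apply: monomial_bound; rewrite ?muln_gt0 ?subnKC ?powR_ge0//.
rewrite [RHS]expr_div_n even_powerE -[RHS]expr_div_n.
set b := (_ / _) ^+ _ * _.
have b_ge0 : 0 <= b.
  apply: mulr_ge0; first by rewrite -even_powerE exprn_ge0.
  by rewrite ratio_azE invr_ge0 ltW.
have [k0|k_gt0] := posnP (2 * d - mdeg a)%N.
  have degE : mdeg a = (2 * d)%N by apply/eqP; rewrite eqn_leq lead -subn_eq0 k0.
  rewrite k0 expr0 mulr1.
  move/(congr1 (GRing.mul ((mcoeff a f / (2 * d)%N%:R) ^+ (2 * d)))): (htop degE).
  rewrite mulr1 mulrA -exprMn mulrA divfK ?divff ?expr1n ?mul1r//.
  by rewrite pnatr_eq0 muln_eq0 /= -lt0n.
rewrite -powR_mulrn ?powR_ge0// -powRrM mulVf ?powRr1//; last by rewrite pnatr_eq0 -lt0n.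
by rewrite /b ratio_azE mulrCA divff ?mulr1 ?gt_eqF.
Qed.

Lemma gp_lower_bound (R : realType) n d (M : R) (f : mpoly n.+1 R)
    (t : gp_point R n) (x : 'I_n.+1 -> R) :
  (0 < d)%N -> (msize f <= (2 * d).+1)%N ->
  gp_feasible d f t -> power_ball d M x ->
  meval (fun=> 0) f + M * pure_coef d f ord0 - gp_objective d M f t
    <= meval x f.
Proof.
case: t => z u d_gt0 degf [[u_gt0 hz] [hsum htop h0 hstep]] xM.
rewrite (meval_decomp x d_gt0 degf).
have x_ge0 i : 0 <= x i ^+ (2 * d) by rewrite -even_powerE exprn_ge0.
have hDelta := Delta_sum_le_Omega_sum d f x.
have hterms :
    - (\sum_(a <- Delta d f)
         (\sum_i z a i * x i ^+ (2 * d) + slack d f a (z a)))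
      <= \sum_(a <- Delta d f) mcoeff a f * \prod_i x i ^+ a i.
  rewrite -sumrN big_seq [leRHS]big_seq; apply: ler_sum => a aD.
  exact: Delta_term_bound (hz a aD) (htop a aD).
have hslack : \sum_(a <- Delta d f) slack d f a (z a) =
    \sum_(a <- Delta_lt d f) slack d f a (z a).
  rewrite /Delta_lt [RHS]big_filter [LHS](bigID (fun a => (mdeg a < 2 * d)%N))/=.
  rewrite [X in _ + X]big1 ?addr0// => a; rewrite -leqNgt -subn_eq0 => /eqP k0.
  by rewrite /slack k0 mul0r.
have hz_u : \sum_(a <- Delta d f) \sum_i z a i * x i ^+ (2 * d)
    <= \sum_i u i * x i ^+ (2 * d).
  rewrite exchange_big; apply: ler_sum => i _; rewrite -mulr_suml ler_wpM2r//.
  by have := hsum i; rewrite -mulr_suml ler_pdivrMr// mul1r.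
(* The last constraint, multiplied by u_(i-1), says that the step from i-1 to i
   does not decrease c - u. *)
have hg : forall i, pure_coef d f ord0 - u ord0 <= pure_coef d f i - u i.
  apply: (@le_from_ord0 R n (fun i => pure_coef d f i - u i)) => i j ij.
  have := hstep i j ij; rewrite -mulrDl ler_pdivrMr// mul1r; lra.
have hg0 : pure_coef d f ord0 - u ord0 <= 0.
  by move: h0; rewrite ler_pdivrMr// mul1r subr_le0.
have hpure : M * (pure_coef d f ord0 - u ord0) <=
    \sum_i pure_coef d f i * x i ^+ (2 * d) - \sum_i u i * x i ^+ (2 * d).
  rewrite -sumrB; under eq_bigr do rewrite -mulrBl.
  (* The common factor is nonpositive, so the bound M on the sum of the
     powers reverses. *)
  apply: (@le_trans _ _ (\sum_i (pure_coef d f ord0 - u ord0) * x i ^+ (2 * d))).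
    by rewrite -mulr_sumr mulrC ler_wnM2l.
  by apply: ler_sum => i _; rewrite ler_wpM2r.
move: hterms; rewrite big_split/= hslack /gp_objective.
rewrite -[X in _ - (_ + X)]/(\sum_(a <- Delta_lt d f) slack d f a (z a)).
lra.
Qed.

Theorem theorem2p4 (R : realType) (n d : nat) (hd : (0 < d)%N)
  (M : R) (hM : 0 < M)
  (f : mpoly n.+1 R) (hdeg : (msize f <= (2 * d).+1)%N)
  (hsorted : forall i j : 'I_n.+1, (i <= j)%N ->
     pure_coef d f j <= pure_coef d f i) :
  exists fmin : R,
    is_minimum (power_ball d M) (fun x : 'I_n.+1 -> R => meval x f) fmin /\
    ((meval (fun=> 0) f + M * pure_coef d f ord0)%:E - gp_value d M f
       <= fmin%:E)%E.
Proof.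
have [fmin fminP] := meval_min f hd (ltW hM).
exists fmin; split => //; have [[x xM fx] _] := fminP.
set A := _ + M * _.
have : ((A - fmin)%:E <= gp_value d M f)%E.
  apply: le_ereal_inf_tmp => _ [t tP <-]; rewrite lee_fin lerBlDr -lerBlDl -fx.
  exact: gp_lower_bound tP xM.
case: (gp_value d M f) => [r| |]; first by rewrite -EFinB !lee_fin => ?; lra.
  by rewrite addeNy leNye.
by rewrite leeNy_eq.
Qed.
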